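(* Let $r\in\mathbb{N}$ and let $\{\varepsilon_{m_1,\ldots,m_r} : m_1,\ldots,m_r\in\mathbb{N}\}$ be independent random variables on a probability space $(\Omega,P)$, each taking only the values $\pm1$, with $P(\varepsilon_{m_1,\ldots,m_r}=1)=P(\varepsilon_{m_1,\ldots,m_r}=-1)=\tfrac12$. Let $\Lambda$ be the von Mangoldt function, and for $n\in\mathbb{N}$, $\omega\in\Omega$ put $$G_r(n,\omega)=\sum_{\substack{m_1,\ldots,m_r\ge1\\ m_1+\cdots+m_r=n}}\varepsilon_{m_1,\ldots,m_r}(\omega)\Lambda(m_1)\cdots\Lambda(m_r).$$ Then, almost surely, the random Dirichlet series $$\Phi_r(s,\omega)=\sum_{n=1}^{\infty}G_r(n,\omega)\,n^{-s}$$ converges for all $s\in\mathbb{C}$ with $\Re s>r/2$.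
   Context: $\Lambda(m)=\log p$ if $m=p^k$ for a prime $p$ and $k\ge1$, and $\Lambda(m)=0$ otherwise. *)

(* Defs.v *)
From HB Require Import structures.
From mathcomp Require Import all_boot all_order all_algebra.
From mathcomp Require Import finmap.
From mathcomp Require Import complex.
From mathcomp Require Import all_classical all_reals all_analysis.

Set Implicit Arguments.
Unset Strict Implicit.
Unset Printing Implicit Defensive.

Import Order.TTheory GRing.Theory Num.Theory.
Import numFieldNormedType.Exports.

Local Open Scope classical_set_scope.
Local Open Scope ring_scope.
Local Open Scope complex_scope.

Definition mutually_independent d (T : measurableType d) (R : realType)
    (P : probability T R) (I : choiceType) (D : set I)
    (X : I -> {RV P >-> R}) : Prop :=
  forall (J : {fset I}) (A : I -> set R),
    [set` J] `<=` D -> (forall i, measurable (A i)) ->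
    P (\bigcap_(i in [set` J]) (X i @^-1` A i)) =
    (\prod_(i <- J) P (X i @^-1` A i))%E.

(* The set is a singleton when [m] is a prime power and empty otherwise; see
   [mangoldt_primeX] and [mangoldt_eq0]. *)
Definition mangoldt (R : realType) (m : nat) : R :=
  xget 0 [set x | exists p k,
    [/\ prime p, (0 < k)%N, m = (p ^ k)%N & x = ln p%:R]].

Lemma mangoldt_primeX (R : realType) (p k : nat) :
  prime p -> (0 < k)%N -> mangoldt R (p ^ k) = ln p%:R.
Proof.
move=> p_pr k_gt0; apply: xget_unique; first by exists p, k.
move=> _ [q [l [q_pr l_gt0 /(congr1 (fun m => pdiv m)) e ->]]].
by move: e; case: k k_gt0 => // k _; case: l l_gt0 => // l _;
  rewrite !pdiv_pfactor // => ->.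
Qed.

Lemma mangoldt_eq0 (R : realType) (m : nat) :
  (forall p k, prime p -> (0 < k)%N -> m <> (p ^ k)%N) -> mangoldt R m = 0.
Proof. by move=> Hm; apply: xgetPN => x [p [k [/Hm pk /pk mk /mk]]]. Qed.

Definition pos_index (r : nat) : set {ffun 'I_r -> nat} :=
  [set m | forall i, (0 < m i)%N].
Arguments pos_index : clear implicits.

Definition compositions (r n : nat) : set {ffun 'I_r -> nat} :=
  [set m | pos_index r m /\ (\sum_(i < r) m i)%N = n].
Arguments compositions : clear implicits.

(* Needed for the finitely supported sum in [Gsum] to be the intended one. *)
Lemma finite_compositions (r n : nat) : finite_set (compositions r n).
Proof.
apply: (@sub_finite_set _ _
  ((fun f : {ffun 'I_r -> 'I_n.+1} => [ffun i => val (f i)]) @` setT)).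
  move=> m [_ sum_m].
  have le_m i : (m i < n.+1)%N.
    by rewrite ltnS -sum_m (bigD1 i) //= leq_addr.
  exists [ffun i => Ordinal (le_m i)] => //.
  by apply/ffunP => i; rewrite !ffunE.
by apply: finite_image; exact: finite_finset.
Qed.

Definition Gsum (R : realType) (T : Type) (r : nat)
    (eps : {ffun 'I_r -> nat} -> T -> R) (n : nat) (w : T) : R :=
  \sum_(m \in compositions r n) eps m w * \prod_(i < r) mangoldt R (m i).

Definition cexp (R : realType) (z : R[i]) : R[i] :=
  (expR (complex.Re z))%:C * (cos (complex.Im z) +i* sin (complex.Im z)).

(* [n ^ z] for [0 < n], through the real logarithm of [n] *)
Definition natpowC (R : realType) (n : nat) (z : R[i]) : R[i] :=
  cexp (z * (ln (n%:R : R))%:C).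

Definition dirichlet_partial_sums (R : realType) (a : nat -> R) (s : R[i]) :
    nat -> R[i]^o :=
  fun N => \sum_(1 <= n < N) (a n)%:C * natpowC n (- s).

(* Main.v *)
Require Import Defs.
From HB Require Import structures.
From mathcomp Require Import all_boot all_order all_algebra.
From mathcomp Require Import finmap.
From mathcomp Require Import complex.
From mathcomp Require Import all_classical all_reals all_analysis.
From mathcomp Require Import measurable_realfun ring lra zify.

(* The signs are orthonormal in [L^2], so the coefficients [G_r n] are pairwise
   orthogonal, and since [Lambda m <= ln m] the sum of the variances of [G_r n]
   over [n < 2 ^ k] is at most [2 ^ (k r) k ^ (2 r)]. By the
   Rademacher-Menshov dyadic decomposition, the square of any partial sum of
   length at most [2 ^ k] is bounded by [k + 1] times the total square sum of the
   dyadic blocks, whose mean is only [k + 1] times larger than that variance.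
   Summing over [k] against a polynomial weight in [k] shows that almost surely
   the partial sums of [G_r] are [O(N ^ tau)] for every [tau > r / 2], and
   summation by parts then gives convergence in the half-plane. The real and
   imaginary parts are handled separately, with the complex power of [n] entering
   only through its size and its Lipschitz constant as a function of [ln n]. *)

Set Implicit Arguments.
Unset Strict Implicit.
Unset Printing Implicit Defensive.

Import Order.TTheory GRing.Theory Num.Theory.
Import numFieldNormedType.Exports.

Local Open Scope classical_set_scope.
Local Open Scope ring_scope.
Local Open Scope complex_scope.

(** * Dyadic blocks and the Rademacher-Menshov inequality *)

(** Total of the squared block sums over the binary tree of dyadic blocks of [[u, u + 2 ^ k)], all
    levels included. *)
Fixpoint dyadic_energy (R : realType) (a : nat -> R) (k u : nat) : R :=
  if k is k'.+1 then
    (\sum_(u <= n < u + 2 ^ k) a n) ^+ 2 +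
    (dyadic_energy a k' u + dyadic_energy a k' (u + 2 ^ k'))
  else a u ^+ 2.

Lemma dyadic_energy_ge_block (R : realType) (a : nat -> R) k u :
  0 <= dyadic_energy a k u /\
  (\sum_(u <= n < u + 2 ^ k) a n) ^+ 2 <= dyadic_energy a k u.
Proof.
elim: k u => [|k IH] u; first by rewrite expn0 addn1 big_nat1 /= sqr_ge0.
have [q1 _] := IH u; have [q2 _] := IH (u + 2 ^ k)%N.
by rewrite [dyadic_energy _ _ _]/=; split;
  rewrite ?addr_ge0 ?sqr_ge0 // lerDl addr_ge0.
Qed.

(** An initial segment splits into at most one dyadic block per level, and Cauchy-Schwarz over these
    at most [k.+1] blocks costs the factor [k.+1]. *)
Lemma sqr_partial_sum_le_energy (R : realType) (a : nat -> R) k u N :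
  (N <= 2 ^ k)%N ->
  (\sum_(u <= n < u + N) a n) ^+ 2 <= k.+1%:R * dyadic_energy a k u.
Proof.
elim: k u N => [|k IH] u N.
  rewrite expn0 mul1r; case: N => [|[|//]] _ /=.
    by rewrite addn0 big_geq // expr0n /= sqr_ge0.
  by rewrite addn1 big_nat1.
move=> leN; rewrite [dyadic_energy _ _ _]/=.
set D := _ ^+ 2 + _; have D0 : 0 <= (\sum_(u <= n < u + 2 ^ k.+1) a n) ^+ 2
  by rewrite sqr_ge0.
have [q1 A1] := dyadic_energy_ge_block a k u.
have [q2 _] := dyadic_energy_ge_block a k (u + 2 ^ k).
have c0 : 0 < k.+1%:R :> R by rewrite ltr0n.
have cS : k.+2%:R = k.+1%:R + 1 :> R by rewrite -addn1 natrD.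
have [le_N|lt_N] := leqP N (2 ^ k).
  apply: le_trans (IH _ _ le_N) _; rewrite cS /D.
  move: D0 q1 q2 c0; set c := k.+1%:R; move: (_ ^+ 2) => x D0 q1 q2 c0.
  by nra.
(* Past the midpoint, the segment is the full left block followed by an initial segment of the right
   half. *)
have leB : (N - 2 ^ k <= 2 ^ k)%N by move: leN; rewrite expnS; lia.
have B1 := IH (u + 2 ^ k)%N _ leB.
rewrite (@big_cat_nat _ _ _ (u + 2 ^ k)) ?leq_addr //=; last by lia.
rewrite -addnA subnKC in B1; last exact: ltnW.
rewrite cS /D.
move: D0 A1 B1 q1 q2 c0; set c := k.+1%:R; move: (_ ^+ 2) => x.
move: (\sum_(u <= n < u + 2 ^ k) a n) (\sum_(u + 2 ^ k <= n < u + N) a n) => A B.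
move: (dyadic_energy _ _ _) (dyadic_energy _ _ _) => p q D0 A1 B1 q1 q2 c0.
(* Cauchy-Schwarz with weights [1] and [c]: [c (A + B)^2 <= (c + 1) (c A^2 + B^2)] *)
have CS : c * (A + B) ^+ 2 <= (c + 1) * (c * A ^+ 2 + B ^+ 2).
  by have := sqr_ge0 (c * A - B); nra.
rewrite -(ler_pM2l c0); apply: le_trans CS _.
have c1 : 0 <= c + 1 by lra.
by rewrite [leRHS]mulrCA ler_wpM2l //; nra.
Qed.

(** * Summation by parts and convergence of Dirichlet series *)

Lemma summation_by_parts (R : comPzRingType) (a b : nat -> R) N :
  \sum_(1 <= n < N.+1) a n * b n =
  (\sum_(1 <= n < N.+1) a n) * b N.+1 +
  \sum_(0 <= i < N) (\sum_(1 <= n < i.+2) a n) * (b i.+1 - b i.+2).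
Proof.
elim: N => [|N IH]; first by rewrite !big_geq // mul0r addr0.
rewrite big_nat_recr //= IH [X in _ = _ + X]big_nat_recr //=.
by rewrite [\sum_(1 <= n < N.+2) a n]big_nat_recr //=; ring.
Qed.

Lemma cvg_summation_by_parts (R : realType) (a b : nat -> R) :
  cvgn (fun N => (\sum_(1 <= n < N) a n) * b N) ->
  cvgn [normed series (fun i => (\sum_(1 <= n < i.+2) a n) * (b i.+1 - b i.+2))] ->
  cvgn (fun N => \sum_(1 <= n < N) a n * b n).
Proof.
move=> cb /normed_cvg cs.
apply/(cvgP (limn (fun N => (\sum_(1 <= n < N) a n) * b N) + limn (series
  (fun i => (\sum_(1 <= n < i.+2) a n) * (b i.+1 - b i.+2))))).
rewrite -(cvg_shiftS (fun N => \sum_(1 <= n < N) a n * b n)) /=.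
under eq_fun do rewrite summation_by_parts.
by apply: cvgD => //; rewrite (cvg_shiftS (fun N => (\sum_(1 <= n < N) a n) * b N)).
Qed.

Lemma expRN_ln_cvg0 (R : realType) (e : R) : 0 < e ->
  (fun n : nat => expR (- e * ln n%:R)) @ \oo --> (0 : R).
Proof.
move=> e0; apply/cvgrPdist_le => x x0.
near=> n.
rewrite sub0r normrN ger0_norm ?expR_ge0 //.
rewrite -[leRHS]lnK ?posrE // ler_expR mulNr lerNl -ler_pdivrMl //.
rewrite -[leLHS]expRK ler_ln ?posrE ?expR_gt0 //.
  near: n; exact: nbhs_infty_ger.
by near: n; apply: filterS (nbhs_infty_gt 0%N) => n; rewrite ltr0n.
Unshelve. all: by end_near. Qed.

(** For [x <= y] this compares a rectangle under the decreasing curve [expR (- e * t)] with the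
    integral over [[x, y]]. The inequality [1 + z <= expR z] replaces the integration. *)
Lemma expR_telescope (R : realType) (e x y : R) : 0 < e ->
  expR (- e * y) * (y - x) <= e^-1 * (expR (- e * x) - expR (- e * y)).
Proof.
move=> e0; rewrite ler_pdivlMl //.
have -> : expR (- e * x) = expR (- e * y) * expR (e * (y - x)).
  by rewrite -expRD; congr expR; ring.
have := expR_ge1Dx (e * (y - x)); have := expR_gt0 (- e * y).
by move: (expR _) (expR _) => p q; nra.
Qed.

(** The terms are dominated by the increments of a bounded monotone sequence. With
    [L n = ln n.+1%:R] this stands in for the convergence of the sum of n^(-1-e). *)
Lemma cvg_series_expR_telescope (R : realType) (e : R) (L : nat -> R) : 0 < e ->
  {homo L : m n / (m <= n)%N >-> m <= n} ->
  cvgn (series (fun n => expR (- e * L n.+1) * (L n.+1 - L n))).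
Proof.
move=> e0 homoL; set c := fun n => - (e^-1 * expR (- e * L n)).
have cc : cvgn c.
  apply: nondecreasing_is_cvgn.
    move=> m n mn; rewrite /c lerN2 ler_pM2l ?invr_gt0 // ler_expR !mulNr lerN2.
    by rewrite ler_pM2l // homoL.
  exists 0 => _ [n _ <-]; rewrite /c oppr_le0 mulr_ge0 ?expR_ge0 //.
  by rewrite invr_ge0 ltW.
have ct : cvgn (series (telescope c)).
  by rewrite telescopeK; apply: is_cvgB => //; exact: is_cvg_cst.
apply: series_le_cvg ct => n; rewrite /telescope.
- by rewrite mulr_ge0 ?expR_ge0 // subr_ge0 homoL.
- rewrite /c /= opprK addrC subr_ge0 ler_pM2l ?invr_gt0 // ler_expR !mulNr lerN2.
  by rewrite ler_pM2l // homoL.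
- by apply: le_trans (expR_telescope _ _ e0) _; rewrite /c /= opprK mulrBr addrC.
Qed.

(** Here [g (ln n%:R)] models the real or imaginary part of n^(-s). In the summation by parts the
    boundary term is O(N^(-e)) with [e = sigma - tau], and the Lipschitz bound reduces the other
    series to the telescoping one. *)
Lemma cvg_dirichlet_kernel (R : realType) (a : nat -> R) (g : R -> R)
    (C K sigma tau : R) :
  0 <= K -> 0 <= sigma -> tau < sigma ->
  (forall N, (0 < N)%N ->
    `|\sum_(1 <= n < N) a n| <= C * expR (tau * ln N%:R)) ->
  (forall x, 0 <= x -> `|g x| <= expR (- sigma * x)) ->
  (forall x y, 0 <= x <= y ->
    `|g x - g y| <= K * expR (- sigma * x) * (y - x)) ->
  cvgn (fun N => \sum_(1 <= n < N) a n * g (ln n%:R)).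
Proof.
move=> K0 sigma0 lt_ts aC gs gK; set e := sigma - tau.
have e0 : 0 < e by rewrite subr_gt0.
(* At [N = 1] the sum is empty and the growth bound is [C] itself. *)
have C0 : 0 <= C.
  have := aC 1%N isT; rewrite ln1 mulr0 expR0 mulr1.
  exact: le_trans (normr_ge0 _).
have ln_homo m n : (0 < m <= n)%N -> ln m%:R <= ln n%:R :> R.
  move=> /andP[m0 mn]; rewrite ler_ln ?posrE ?ltr0n ?ler_nat //.
  exact: leq_trans mn.
have ln_nat0 n : 0 <= ln n.+1%:R :> R by apply: ln_ge0; rewrite ler1n.
apply: cvg_summation_by_parts.
  apply/(cvgP (0 : R)); apply/norm_cvg0P.
  apply: (@squeeze_cvgr _ _ _ _ (cst 0) (fun n : nat => C * expR (- e * ln n%:R))).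
  - near=> N; rewrite /cst normr_ge0 /= normrM.
    have N0 : (0 < N)%N by near: N; exact: nbhs_infty_gt.
    have -> : - e * ln N%:R = tau * ln N%:R + - sigma * ln N%:R.
      by rewrite /e; ring.
    rewrite expRD mulrA ler_pM ?normr_ge0 ?aC // gs //.
    by rewrite -(prednK N0).
  - exact: cvg_cst.
  - rewrite -[X in _ --> X](mulr0 C); apply: cvgMr; exact: expRN_ln_cvg0.
(* The factor [expR (sigma * ln 2)] pays for moving the decay from [ln i.+1%:R] to [ln i.+2%:R],
   which differ by at most [ln 2]. *)
have : cvgn (series (fun i => (C * K * expR (sigma * ln 2)) *
    (expR (- e * ln i.+2%:R) * (ln i.+2%:R - ln i.+1%:R)))).
  apply: (@is_cvg_seriesZ _ (fun i =>
    expR (- e * ln i.+2%:R) * (ln i.+2%:R - ln i.+1%:R)) (C * K * expR (sigma * ln 2))).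
  apply: (cvg_series_expR_telescope (L := fun i => ln i.+1%:R)) => //.
  by move=> m n mn; apply: ln_homo.
apply: series_le_cvg => i //.
- exact: normr_ge0.
- by rewrite mulr_ge0 ?mulr_ge0 ?expR_ge0 // subr_ge0 ln_homo /=.
- rewrite /=; have ii : ln i.+1%:R <= ln i.+2%:R :> R by rewrite ln_homo /=.
  rewrite normrM.
  apply: le_trans (ler_pM (normr_ge0 _) (normr_ge0 _) (aC _ _) (gK _ _ _)) _ => //.
    by rewrite ln_nat0.
  rewrite !mulrA ler_wpM2r ?subr_ge0 //.
  have -> : C * expR (tau * ln i.+2%:R) * K * expR (- sigma * ln i.+1%:R) =
    C * K * expR (tau * ln i.+2%:R - sigma * ln i.+1%:R).
    by rewrite expRD mulNr; ring.
  rewrite -(mulrA (C * K)) -expRD ler_wpM2l ?mulr_ge0 // ler_expR.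
  have : ln i.+2%:R <= ln 2 + ln i.+1%:R :> R.
    rewrite -lnM ?posrE // -natrM ln_homo //; lia.
  by rewrite /e; move: (ln _) (ln _) (ln _) => x y z; nra.
Unshelve. all: by end_near. Qed.

(** By the mean value theorem: the derivative is [expR (- sigma * z) * (dh z - sigma * h z)], and
    the exponential is largest at the left endpoint [x]. *)
Lemma expR_lipschitz (R : realType) (K sigma : R) (h dh : R -> R) :
  0 <= sigma ->
  (forall x : R, is_derive x 1 h (dh x)) ->
  (forall x, `|h x| <= 1) -> (forall x, `|dh x| <= K) ->
  forall x y, x <= y ->
  `|expR (- sigma * x) * h x - expR (- sigma * y) * h y| <=
  (sigma + K) * expR (- sigma * x) * (y - x).
Proof.
move=> sigma0 dhP h1 dhK x y xy.
pose f (z : R) : R := expR (- sigma * z) * h z.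
pose df (z : R) : R := expR (- sigma * z) * (dh z - sigma * h z).
have dfP (z : R) : is_derive z 1 f (df z).
  have := dhP z => dhz.
  have dl : is_derive z 1 (fun t : R => - sigma * t) (- sigma).
    by apply: is_derive_eq; rewrite /= ?scaler0 ?add0r ?addr0 /GRing.scale /= mulr1.
  have de := is_derive1_comp (is_derive_expR (- sigma * z)) dl.
  apply: (@is_derive_eq _ _ _ _ _ _ _ _ (is_deriveM de dhz)).
  by rewrite /df /GRing.scale /=; ring.
rewrite distrC.
have cf : {within `[x, y], continuous f}.
  by apply: derivable_within_continuous => z _; apply: ex_derive.
have [c] := MVT_segment xy (fun z _ => dfP z) cf.
rewrite in_itv /= => /andP[xc cy]; rewrite -/(f x) -/(f y) => ->.
rewrite normrM (ger0_norm (x := y - x)) ?subr_ge0 // ler_wpM2r ?subr_ge0 //.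
rewrite /df normrM ger0_norm ?expR_ge0 // mulrC ler_pM ?expR_ge0 //.
  rewrite [leRHS]addrC (le_trans (ler_normB _ _)) // lerD // normrM (ger0_norm sigma0).
  by rewrite ler_piMr.
by rewrite ler_expR !mulNr lerN2 ler_wpM2l.
Qed.

Lemma cvg_complex_Re_Im (R : realType) (u : nat -> R[i]^o) :
  cvgn (fun n => complex.Re (u n)) -> cvgn (fun n => complex.Im (u n)) ->
  cvgn u.
Proof.
set lr := limn (fun n => complex.Re (u n)).
set li := limn (fun n => complex.Im (u n)) => cr ci.
apply/(cvgP (lr +i* li : R[i]^o)); apply/cvgrPdist_le => -[e e'].
(* A positive element of [R[i]] is real, so the radius has no imaginary part. *)
rewrite ltcE /= => /andP[/eqP -> e0].
have e2 : 0 < e / 2 by rewrite divr_gt0.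
near=> n.
have -> : lr +i* li - u n =
    (lr - complex.Re (u n))%:C + 'i * (li - complex.Im (u n))%:C.
  by case: (u n) => a b; simpc.
rewrite (le_trans (ler_normD _ _)) // normrM.
have -> : `|'i : R[i]| = 1 by rewrite normc_def /= expr0n expr1n add0r sqrtr1.
rewrite mul1r !normc_def /= !expr0n /= !addr0 !sqrtr_sqr.
rewrite -[e +i* 0]/(e%:C) [e]splitr rmorphD lerD // lecR.
  by near: n; apply: (cvgr_dist_le _ _ cr).
by near: n; apply: (cvgr_dist_le _ _ ci).
Unshelve. all: by end_near. Qed.

Lemma cvg_dirichlet (R : realType) (a : nat -> R) (C tau : R) (s : R[i]) :
  0 <= complex.Re s -> tau < complex.Re s ->
  (forall N, (0 < N)%N ->
    `|\sum_(1 <= n < N) a n| <= C * expR (tau * ln N%:R)) ->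
  cvgn (dirichlet_partial_sums a s).
Proof.
case: s => sigma t /= sigma0 lt_ts aC.
(* Used twice, with [h] the cosine and then the sine of [- t * x], whose derivatives are at most
   [|t|] in size. *)
have lipschitz (h dh : R -> R) : (forall x : R, is_derive x 1 h (dh x)) ->
    (forall x, `|h x| <= 1) -> (forall x, `|dh x| <= `|t|) ->
    cvgn (fun N => \sum_(1 <= n < N)
      a n * (expR (- sigma * ln n%:R) * h (ln n%:R))).
  move=> dhP h1 dht.
  apply: (@cvg_dirichlet_kernel _ a (fun x => expR (- sigma * x) * h x)
    C (sigma + `|t|) sigma tau) => //.
  - by rewrite addr_ge0.
  - by move=> x _; rewrite normrM ger0_norm ?expR_ge0 // ler_piMr ?expR_ge0.
  - by move=> x y /andP[_ xy]; apply: expR_lipschitz xy.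
have dl (x : R) : is_derive x 1 (fun z : R => - t * z) (- t).
  by apply: is_derive_eq; rewrite /= ?scaler0 ?add0r ?addr0 /GRing.scale /= mulr1.
have term n : (a n)%:C * natpowC n (- (sigma +i* t)) =
    (a n * (expR (- sigma * ln n%:R) * cos (- t * ln n%:R))) +i*
    (a n * (expR (- sigma * ln n%:R) * sin (- t * ln n%:R))).
  by rewrite /natpowC /cexp; simpc.
have ReD : {morph @complex.Re R : x y / x + y} by move=> [? ?] [? ?].
have ImD : {morph @complex.Im R : x y / x + y} by move=> [? ?] [? ?].
apply: cvg_complex_Re_Im; rewrite /dirichlet_partial_sums.
  have -> : (fun n => complex.Re (\sum_(1 <= i < n)
      (a i)%:C * natpowC i (- (sigma +i* t)))) = (fun n => \sum_(1 <= i < n)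
      a i * (expR (- sigma * ln i%:R) * cos (- t * ln i%:R))).
    apply/funext => n; rewrite (big_morph _ ReD (erefl _)).
    by apply: eq_bigr => i _; rewrite term.
  apply: (lipschitz (cos \o (fun x => - t * x))
    (fun x => - sin (- t * x) * - t)) => [x|x].
  - exact: cos_max.
  - by rewrite normrM !normrN ler_piMl ?sin_max.
have -> : (fun n => complex.Im (\sum_(1 <= i < n)
    (a i)%:C * natpowC i (- (sigma +i* t)))) = (fun n => \sum_(1 <= i < n)
    a i * (expR (- sigma * ln i%:R) * sin (- t * ln i%:R))).
  apply/funext => n; rewrite (big_morph _ ImD (erefl _)).
  by apply: eq_bigr => i _; rewrite term.
apply: (lipschitz (sin \o (fun x => - t * x))
  (fun x => cos (- t * x) * - t)) => [x|x].
- exact: sin_max.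
- by rewrite normrM normrN ler_piMl ?cos_max.
Qed.

(** * From dyadic square bounds to power growth *)

Lemma expr_le_expR (R : realType) (c x : R) p : 0 < c -> 0 <= x ->
  x ^+ p <= p`!%:R / c ^+ p * expR (c * x).
Proof.
move=> c0 x0.
have -> : x ^+ p = (c * x) ^+ p / c ^+ p.
  by rewrite exprMn mulrAC divff ?mul1r // expf_neq0 // gt_eqF.
have cx : 0 <= c * x by rewrite mulr_ge0 // ltW.
rewrite mulrAC ler_wpM2r ?invr_ge0 ?exprn_ge0 ?(ltW c0) //.
case: p => [|p].
  by rewrite expr0 fact0; have := expR_ge1Dx (c * x); lra.
rewrite -ler_pdivrMl ?ltr0n ?fact_gt0 // mulrC.
by have := expR_ge1Dxn p cx; lra.
Qed.

(** Take [2 ^ k <= N < 2 ^ k.+1]. The bound at level [k.+1] is N^r up to a constant, times a power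
    of [k.+2] that is absorbed by N^e with [e = 2 * tau - r%:R]. *)
Lemma dyadic_growth (R : realType) (S : nat -> R) (C tau : R) r p :
  r%:R / 2 < tau ->
  (forall k N, (N <= 2 ^ k)%N -> S N ^+ 2 <= C * ((2 ^+ k) ^+ r * k.+1%:R ^+ p)) ->
  exists C' : R, forall N, (0 < N)%N -> `|S N| <= C' * expR (tau * ln N%:R).
Proof.
move=> lt_rt SC; set e := 2 * tau - r%:R.
have e0 : 0 < e by rewrite /e; lra.
have C0 : 0 <= C.
  have := SC 0%N 0%N isT; rewrite expr0 !expr1n !mulr1.
  exact/le_trans/sqr_ge0.
have ln20 : 0 < ln 2 :> R by rewrite ln_gt0 // ltr1n.
(* With this [c], [expR (c * k%:R)] is (2^k)^e, at most N^e. The factor [expR (2 * c)] in [D]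
   accounts for [k.+2] in place of [k]. *)
set c := e * ln 2; have c0 : 0 < c by rewrite mulr_gt0.
set D := p`!%:R / c ^+ p * expR (2 * c).
have D0 : 0 <= D by rewrite mulr_ge0 ?expR_ge0 // divr_ge0 ?exprn_ge0 ?(ltW c0).
exists (Num.sqrt (C * (2 ^+ r * D))) => N N0.
set k := trunc_log 2 N; set L := ln N%:R.
have N0' : 0 < N%:R :> R by rewrite ltr0n.
have ltN : (N < 2 ^ k.+1)%N by exact: trunc_log_ltn.
have leN : (2 ^ k <= N)%N by exact: trunc_logP.
have kL : k%:R * ln 2 <= L.
  by rewrite mulr_natl -lnXn // -natrX ler_ln ?posrE ?ltr0n ?expn_gt0 // ler_nat.
have SL : S N ^+ 2 <= C * (2 ^+ r * D) * expR (tau * L) ^+ 2.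
  apply: le_trans (SC _ _ (ltnW ltN)) _; rewrite -mulrA ler_wpM2l //.
  have -> : expR (tau * L) ^+ 2 = N%:R ^+ r * expR (e * L).
    rewrite -[N%:R in RHS]lnK ?posrE // -!expRM_natr -expRD -/L /e.
    by congr expR; ring.
  rewrite mulrACA -exprMn; apply: ler_pM.
  - by rewrite !exprn_ge0.
  - by rewrite exprn_ge0.
  - rewrite lerXn2r ?nnegrE ?exprn_ge0 ?mulr_ge0 //.
    by rewrite exprS ler_pM2l // -natrX ler_nat.
  - apply: le_trans (expr_le_expR p c0 (ler0n _ _)) _.
    rewrite /D -[leRHS]mulrA ler_wpM2l ?divr_ge0 ?exprn_ge0 ?(ltW c0) // -expRD ler_expR.
    have : c * k%:R <= e * L by rewrite /c -mulrA ler_pM2l // mulrC.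
    by rewrite -addn2 natrD; lra.
rewrite -sqrtr_sqr; apply: le_trans (ler_wsqrtr SL) _.
rewrite sqrtrM; first by rewrite sqrtr_sqr ger0_norm ?expR_ge0.
by rewrite mulr_ge0 // mulr_ge0 // exprn_ge0.
Qed.

(** * Means, orthogonality and almost sure bounds *)

(** Integrability travels with the value, so linearity holds without side conditions and values stay
    in [R]. *)
Definition has_mean d (T : measurableType d) (R : realType)
    (P : probability T R) (f : T -> R) (c : R) : Prop :=
  P.-integrable setT (EFin \o f) /\ (\int[P]_x (f x)%:E)%E = c%:E.

Section has_mean.
Context d (T : measurableType d) (R : realType) (P : probability T R).

Lemma has_mean_indic (A : set T) (p : R) :
  measurable A -> P A = p%:E -> has_mean P (\1_A) p.
Proof.
move=> mA PA; split; last by rewrite integral_indic // setIT.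
exact: integrable_indic.
Qed.

Lemma has_meanZ (k : R) (f : T -> R) (c : R) :
  has_mean P f c -> has_mean P (fun w => k * f w) (k * c).
Proof.
move=> [intf Ef]; split; first by apply: eq_integrable (integrableZl measurableT k intf).
under eq_integral do rewrite EFinM.
by rewrite integralZl // Ef.
Qed.

Lemma has_meanD (f g : T -> R) (a b : R) :
  has_mean P f a -> has_mean P g b -> has_mean P (fun w => f w + g w) (a + b).
Proof.
move=> [intf Ef] [intg Eg]; split; first by apply: eq_integrable (integrableD measurableT intf intg).
by rewrite [LHS]integralD_EFin // Ef Eg.
Qed.

Lemma has_mean_cst (c : R) : has_mean P (cst c) c.
Proof.
split; first exact: finite_measure_integrable_cst.
transitivity (\int[P]_x cst c%:E x)%E; first by [].
by rewrite integral_cst //= [X in (_ * X)%E]probability_setT mule1.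
Qed.

Lemma has_mean_sum (I : Type) (s : seq I) (Q : pred I) (f : I -> T -> R)
    (c : I -> R) :
  (forall i, Q i -> has_mean P (f i) (c i)) ->
  has_mean P (fun w => \sum_(i <- s | Q i) f i w) (\sum_(i <- s | Q i) c i).
Proof.
move=> fc; elim: s => [|i s IH].
  rewrite big_nil (_ : (fun w => _) = cst 0); first exact: has_mean_cst.
  by apply/funext => w; rewrite big_nil.
under eq_fun do rewrite big_cons.
rewrite big_cons; case: ifP => // Qi.
by apply: has_meanD => //; exact: fc.
Qed.

Lemma has_mean_sqr_sum (I : choiceType) (s : seq I) (X : I -> T -> R) (v : I -> R) :
  uniq s ->
  (forall i j, has_mean P (fun w => X i w * X j w) (v i *+ (i == j))) ->
  has_mean P (fun w => (\sum_(i <- s) X i w) ^+ 2) (\sum_(i <- s) v i).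
Proof.
move=> us Xv.
under eq_fun do rewrite expr2 mulr_suml.
have -> : \sum_(i <- s) v i = \sum_(i <- s) \sum_(j <- s) v i *+ (i == j).
  apply: eq_big_seq => i si; rewrite (bigD1_seq i) //= eqxx big1 ?addr0 // => j.
  by rewrite eq_sym => /negbTE ->.
apply: has_mean_sum => i _; under eq_fun do rewrite mulr_sumr.
by apply: has_mean_sum.
Qed.

(** Each of the [k.+1] levels partitions the interval into blocks and, by orthogonality, contributes
    the full sum of [v] once. *)
Lemma has_mean_dyadic_energy (X : nat -> T -> R) (v : nat -> R) k u :
  (forall i j, has_mean P (fun w => X i w * X j w) (v i *+ (i == j))) ->
  has_mean P (fun w => dyadic_energy (fun n => X n w) k u)
    (k.+1%:R * \sum_(u <= n < u + 2 ^ k) v n).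
Proof.
move=> Xv; elim: k u => [|k IH] u.
  rewrite expn0 addn1 big_nat1 mul1r /=; have := Xv u u.
  by rewrite eqxx mulr1n.
rewrite /=; have -> : k.+2%:R * \sum_(u <= n < u + 2 ^ k.+1) v n =
    \sum_(u <= n < u + 2 ^ k.+1) v n + (k.+1%:R * \sum_(u <= n < u + 2 ^ k) v n +
     k.+1%:R * \sum_(u + 2 ^ k <= n < u + 2 ^ k + 2 ^ k) v n).
  rewrite -mulrDr -big_cat_nat ?leq_addr //= -addnA addnn -mul2n -expnS.
  by rewrite -[k.+2]addn1 natrD; ring.
apply: has_meanD; last exact: has_meanD.
by apply: has_mean_sqr_sum => //; rewrite iota_uniq.
Qed.

(** By monotone convergence the series of the [f k] has mean at most [B], so it is finite almost
    everywhere, and its value bounds each nonnegative term. *)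
Lemma ae_bounded_summable_means (f : nat -> T -> R) (v : nat -> R) (B : R) :
  (forall k w, 0 <= f k w) -> (forall k, has_mean P (f k) (v k)) ->
  (forall N, \sum_(0 <= k < N) v k <= B) ->
  \forall w \ae P, exists C : R, forall k, f k w <= C.
Proof.
move=> f0 fv vB; pose g w : \bar R := (\sum_(0 <= k <oo) (f k w)%:E)%E.
have mf k : measurable_fun [set: T] (EFin \o f k : T -> \bar R).
  by have [/integrableP[]] := fv k.
have g0 w : (0 <= g w)%E by apply: nneseries_ge0 => k _ _; rewrite lee_fin.
have intg : P.-integrable setT g.
  apply/integrableP; split.
    apply: (ge0_emeasurable_sum (h := fun k => EFin \o f k) (P := predT)) => //.
    by move=> k w _ _; rewrite /= lee_fin.
  under eq_integral do rewrite gee0_abs //.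
  rewrite integral_nneseries //; last by move=> k w _; rewrite lee_fin.
  apply: (@le_lt_trans _ _ B%:E); last exact: ltry.
  apply: lime_le.
    by apply: is_cvg_nneseries => k _ _; apply: integral_ge0 => w _; rewrite lee_fin.
  apply: nearW => N.
  by under eq_bigr do rewrite (fv _).2; rewrite sumEFin lee_fin.
apply: filterS (integrable_ae measurableT intg) => w /(_ I) gw.
exists (fine (g w)) => k; rewrite -lee_fin fineK //.
apply: le_trans (nneseries_lim_ge k.+1 _); last by move=> *; rewrite lee_fin.
rewrite big_nat_recr //= leeDr // sume_ge0 // => i _; by rewrite lee_fin.
Qed.

End has_mean.

(** * Second moments of the coefficients *)

Lemma mangoldt_ge0_le_ln (R : realType) (m : nat) :
  0 <= mangoldt R m <= ln m%:R.
Proof.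
have [[p [k [p_pr k_gt0 ->]]]|npk] :=
  pselect (exists p k, [/\ prime p, (0 < k)%N & m = (p ^ k)%N]); last first.
  rewrite mangoldt_eq0 ?lexx /=; last first.
    by move=> p k p_pr k_gt0 mE; apply: npk; exists p, k.
  (* The case [m = 0] rests on the default value [ln 0 = 0]. *)
  by case: (m) => [|n]; [rewrite ln0 | rewrite ln_ge0 // ler1n].
rewrite mangoldt_primeX // natrX lnXn ?ltr0n ?prime_gt0 //.
have lnp : 0 <= ln p%:R :> R by rewrite ln_ge0 // ler1n prime_gt0.
by rewrite lnp -[leRHS]mulr_natr ler_peMr // ler1n.
Qed.

Lemma has_mean_sign_mul d (T : measurableType d) (R : realType)
    (P : probability T R) (I : choiceType) (D : set I) (X : I -> {RV P >-> R}) :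
  mutually_independent D X ->
  (forall i, D i -> forall w, X i w = 1 \/ X i w = -1) ->
  (forall i, D i -> P (X i @^-1` [set 1]) = (2^-1)%:E) ->
  forall i j, D i -> D j ->
  has_mean P (fun w => X i w * X j w) (i == j)%:R.
Proof.
move=> indep pm1 X1 i j Di Dj.
pose A k := X k @^-1` [set (1 : R)].
(* A sign is affine in the indicator of an event, so only the probabilities of
   pairwise intersections are needed. *)
have XE k : D k -> forall w, X k w = 2 * \1_(A k) w - 1.
  move=> Dk w; rewrite indicE; have [Xk|Xk] := pm1 k Dk w; rewrite Xk.
    by rewrite mem_set //= mulr1 addrK.
  rewrite memNset ?mulr0 ?sub0r // /A /= Xk => E.
  by exfalso; lra.
have mA k : measurable (A k).
  by rewrite -[A k]setTI; apply: measurable_funP.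
have [<-|neq] := eqVneq i j.
  rewrite (_ : (fun w => _) = cst 1); first exact: has_mean_cst.
  by apply/funext => w; case: (pm1 i Di w) => ->; rewrite ?mulrNN mulr1.
have PAA : P (A i `&` A j) = (2^-1 * 2^-1)%:E.
  have := indep [fset i; j]%fset (fun=> [set 1]).
  rewrite big_fsetU1 ?inE //= big_seq_fset1 !X1 // -EFinM => <- //.
  - congr (P _); apply/seteqP; split => [w [Ai Aj] k /=|w].
      by rewrite !inE => /orP[] /eqP ->.
    by move=> h; split; apply: h; rewrite /= !inE eqxx ?orbT.
  - by move=> k /=; rewrite !inE => /orP[] /eqP ->.
have mean_ij := has_mean_indic (measurableI _ _ (mA i) (mA j)) PAA.
have mean_i := has_mean_indic (mA i) (X1 i Di).
have mean_j := has_mean_indic (mA j) (X1 j Dj).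
(* Expansion of the product of [2 * \1_(A i) - 1] and [2 * \1_(A j) - 1]; the means add up to 1 - 1
   - 1 + 1 = 0. *)
have := has_meanD (has_meanD (has_meanZ 4 mean_ij) (has_meanZ (- 2) mean_i))
  (has_meanD (has_meanZ (- 2) mean_j) (has_mean_cst P 1)).
congr (has_mean P _ _); last by rewrite /= mulr0n; field.
apply/funext => w; rewrite (XE i Di) (XE j Dj) indicI /=.
by ring.
Qed.

Section Gsum.
Context (R : realType) (r : nat).

Let lam (m : {ffun 'I_r -> nat}) : R := \prod_(i < r) mangoldt R (m i).

Definition Gsum_variance (n : nat) : R :=
  \sum_(m <- fset_set (compositions r n)) lam m ^+ 2.

(** Only the diagonal [m = m'] survives, and a tuple determines its sum, so distinct [n] and [n']
    share no composition. *)
Lemma has_mean_Gsum_mul d (T : measurableType d) (P : probability T R)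
    (eps : {ffun 'I_r -> nat} -> {RV P >-> R}) :
  (forall m m', pos_index r m -> pos_index r m' ->
    has_mean P (fun w => eps m w * eps m' w) (m == m')%:R) ->
  forall n n',
  has_mean P (fun w => Gsum eps n w * Gsum eps n' w) (Gsum_variance n *+ (n == n')).
Proof.
move=> orth n n'.
have mem_comp k m : m \in fset_set (compositions r k) -> compositions r k m.
  by rewrite in_fset_set ?inE //; exact: finite_compositions.
(* The membership filters keep at hand the positivity of the indices, which [orth] requires. *)
rewrite (_ : (fun w => _) = (fun w =>
    \sum_(m <- fset_set (compositions r n) | m \in fset_set (compositions r n))
    \sum_(m' <- fset_set (compositions r n') | m' \in fset_set (compositions r n'))
      (lam m * lam m') * (eps m w * eps m' w))); last first.
  apply/funext => w; rewrite /Gsum !fsbig_finite; try exact: finite_compositions.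
  rewrite mulr_suml [LHS]big_seq; apply: eq_bigr => m _.
  rewrite mulr_sumr [LHS]big_seq; apply: eq_bigr => m' _.
  by rewrite -!/(lam _); ring.
have -> : Gsum_variance n *+ (n == n') =
    \sum_(m <- fset_set (compositions r n) | m \in fset_set (compositions r n))
    \sum_(m' <- fset_set (compositions r n') | m' \in fset_set (compositions r n'))
      lam m * lam m' * (m == m')%:R.
  rewrite /Gsum_variance -big_seq -sumrMnl; apply: eq_big_seq => m mJ; rewrite -big_seq.
  have [<-|neq] := eqVneq n n'.
    rewrite (bigD1_seq m) //= ?fset_uniq // eqxx mulr1 big1 ?addr0 // => m'.
    by rewrite eq_sym => /negbTE ->; rewrite mulr0.
  rewrite mulr0n big_seq big1 // => m' m'J; case: eqP => [mm'|]; last by rewrite mulr0.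
  have [_ E] := mem_comp _ _ mJ; have [_ E'] := mem_comp _ _ m'J.
  by move: neq; rewrite -E -E' mm' eqxx.
apply: has_mean_sum => m mJ; apply: has_mean_sum => m' m'J; apply: has_meanZ.
by apply: orth; [case: (mem_comp _ _ mJ) | case: (mem_comp _ _ m'J)].
Qed.

(** A tuple with sum below [2 ^ k] has all entries below [2 ^ k], so there are at most [(2 ^ k) ^ r]
    of them, and each entry satisfies [mangoldt R (m i) <= k * ln 2 <= k]. *)
Lemma sum_Gsum_variance_le k :
  \sum_(0 <= n < 2 ^ k) Gsum_variance n <= (2 ^+ k) ^+ r * (k%:R ^+ 2) ^+ r.
Proof.
have mem_comp n m : m \in fset_set (compositions r n) -> (\sum_(i < r) m i)%N = n.
  by rewrite in_fset_set ?inE => [[]|]; last exact: finite_compositions.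
pose s := [seq m | n <- index_iota 0 (2 ^ k), m <- fset_set (compositions r n)].
have memP m : m \in s -> forall i, (m i < 2 ^ k)%N.
  move=> /allpairsPdep[n [m' [+ m'J ->]]] i.
  rewrite mem_index_iota /= -(mem_comp _ _ m'J); apply: leq_ltn_trans.
  by rewrite (bigD1 i) //= leq_addr.
(* No tuple is listed twice, since its sum recovers the [n] it came from. *)
have us : uniq s.
  apply: allpairs_uniq_dep => [|n _|]; rewrite ?iota_uniq ?fset_uniq //.
  move=> _ _ /allpairsPdep[n1 [m1 [_ m1J ->]]] /allpairsPdep[n2 [m2 [_ m2J ->]]] /= E.
  by move: m2J m1J; rewrite -E => /mem_comp <- /mem_comp <-.
pose emb (f : {ffun 'I_r -> 'I_(2 ^ k)}) : {ffun 'I_r -> nat} :=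
  [ffun i => val (f i)].
have size_s : (size s <= (2 ^ k) ^ r)%N.
  have -> : ((2 ^ k) ^ r)%N = size
      [seq emb f | f <- enum {: {ffun 'I_r -> 'I_(2 ^ k)}}].
    by rewrite size_map -cardE card_ffun !card_ord.
  apply: uniq_leq_size => // m /memP lt_m; apply/mapP.
  exists [ffun i => Ordinal (lt_m i)]; first by rewrite mem_enum.
  by apply/ffunP => i; rewrite !ffunE.
have -> : \sum_(0 <= n < 2 ^ k) Gsum_variance n = \sum_(m <- s) lam m ^+ 2.
  by rewrite big_allpairs_dep.
apply: (@le_trans _ _ (\sum_(m <- s) (k%:R ^+ 2) ^+ r)).
  rewrite big_seq [leRHS]big_seq ler_sum // => m /memP lt_m.
  rewrite -prodrXl -[X in _ ^+ X]card_ord -prodr_const; apply: ler_prod => i _.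
  have /andP[L0 Lln] := mangoldt_ge0_le_ln R (m i).
  rewrite sqr_ge0 lerXn2r ?nnegrE // (le_trans Lln) //.
  have [->|m0] := posnP (m i); first by rewrite ln0.
  apply: (@le_trans _ _ (ln ((2 ^ k)%:R))).
    by rewrite ler_ln ?posrE ?ltr0n ?expn_gt0 // ler_nat ltnW.
  rewrite natrX lnXn // -[leLHS]mulr_natl ler_piMr //.
  by have := @le_ln1Dx R 1; lra.
rewrite big_const_seq count_predT iter_addr_0 -[leLHS]mulr_natl ler_wpM2r ?exprn_ge0 //.
by rewrite -!natrX ler_nat.
Qed.

End Gsum.

(** * Weights over the dyadic scales and conclusion *)

Lemma sum_inv_sqr_le2 (R : realFieldType) N :
  \sum_(0 <= k < N) (k.+1%:R ^+ 2)^-1 <= 2 :> R.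
Proof.
case: N => [|N]; first by rewrite big_geq.
(* The bound is sharpened by [N.+1%:R^-1] so that the induction closes. *)
suff : \sum_(0 <= k < N.+1) (k.+1%:R ^+ 2)^-1 <= 2 - N.+1%:R^-1 :> R.
  by move/le_trans; apply; rewrite gerBl invr_ge0.
elim: N => [|N IH]; first by rewrite big_nat1 expr1n invr1; lra.
rewrite big_nat_recr //=; apply: le_trans (lerD IH (lexx _)) _.
have x0 : 0 < N.+1%:R :> R by rewrite ltr0n.
have -> : N.+2%:R = N.+1%:R + 1 :> R by rewrite -addn1 natrD.
move: x0; move: (N.+1%:R) => x x0.
have x1 : 0 < x + 1 by lra.
rewrite -addrA lerD2l -subr_ge0.
have -> : - (x + 1)^-1 - (- x^-1 + ((x + 1) ^+ 2)^-1) = (x * (x + 1) ^+ 2)^-1.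
  by field; rewrite !gt_eqF.
by rewrite invr_ge0 mulr_ge0 ?exprn_ge0 ?(ltW x0) ?(ltW x1).
Qed.

Theorem theorem2 (R : realType) (d : measure_display) (T : measurableType d)
    (P : probability T R) (r : nat) (r_gt0 : (0 < r)%N)
    (eps : {ffun 'I_r -> nat} -> {RV P >-> R})
    (eps_indep : mutually_independent (pos_index r) eps)
    (eps_pm1 : forall m, pos_index r m ->
      forall w, eps m w = 1 \/ eps m w = -1)
    (eps_1 : forall m, pos_index r m ->
      P (eps m @^-1` [set 1]) = (2^-1)%:E)
    (eps_N1 : forall m, pos_index r m ->
      P (eps m @^-1` [set -1]) = (2^-1)%:E) :
  \forall w \ae P, forall s : R[i], r%:R / 2 < complex.Re s ->
    cvgn (dirichlet_partial_sums (fun n => Gsum eps n w) s).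
Proof.
(* The dyadic blocks start at 0 and the Dirichlet series at 1; this reconciles them. *)
have G0 w : Gsum eps 0 w = 0.
  rewrite /Gsum (_ : compositions r 0 = set0) ?fsbig_set0 //.
  apply/seteqP; split => // m [pos_m] /eqP.
  rewrite (bigD1 (Ordinal r_gt0)) //= addn_eq0 => /andP[/eqP m0 _].
  by have := pos_m (Ordinal r_gt0); rewrite m0.
(* Of the exponent [2 * r + 4], the part [2 * r] absorbs the logarithms in the variance, 2 the
   factors [k.+1] from the maximal inequality and from the mean energy, and the last 2 leave a
   summable inverse square. *)
pose wt k : R := ((2 ^+ k) ^+ r * k.+1%:R ^+ (2 * r + 4))^-1.
have wt0 k : 0 <= wt k by rewrite invr_ge0 mulr_ge0 ?exprn_ge0.
pose f k w := wt k * (k.+1%:R * dyadic_energy (fun n => Gsum eps n w) k 0).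
pose v k :=
  wt k * (k.+1%:R * (k.+1%:R * \sum_(0 <= n < 2 ^ k) Gsum_variance R r n)).
have f0 k w : 0 <= f k w.
  by rewrite mulr_ge0 // mulr_ge0 //; exact: (dyadic_energy_ge_block _ _ _).1.
have orth := has_mean_sign_mul eps_indep eps_pm1 eps_1.
have fv k : has_mean P (f k) (v k).
  apply: has_meanZ; apply: has_meanZ.
  exact: (has_mean_dyadic_energy k 0 (has_mean_Gsum_mul orth)).
have vB N : \sum_(0 <= k < N) v k <= 2.
  apply: le_trans (sum_inv_sqr_le2 R N); apply: ler_sum => k _.
  rewrite /v /wt ler_pdivrMl ?mulr_gt0 ?exprn_gt0 ?ltr0n //.
  rewrite mulrA -expr2 (_ : (2 * r + 4 = 2 * r + 2 + 2)%N); last by lia.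
  rewrite [X in _ <= _ * X / _]exprD [X in _ <= X / _]mulrA.
  rewrite mulfK ?expf_neq0 ?pnatr_eq0 // exprD mulrA [leRHS]mulrC.
  rewrite ler_pM2l ?exprn_gt0 ?ltr0n //.
  apply: le_trans (sum_Gsum_variance_le R r k) _.
  by rewrite -[X in _ * X <= _]exprM ler_wpM2l ?exprn_ge0 // lerXn2r ?nnegrE // ler_nat.
(* The null set and [C] are fixed before [s], so one exceptional set serves the whole half-plane. *)
apply: filterS (ae_bounded_summable_means f0 fv vB) => w [C fC] s lt_s.
(* The midpoint leaves room on both sides: for the growth bound and for the convergence. *)
set tau := (r%:R / 2 + complex.Re s) / 2.
have lt_tau : r%:R / 2 < tau by rewrite /tau; lra.
have [C' SC'] : exists C' : R, forall N, (0 < N)%N ->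
    `|\sum_(0 <= n < N) Gsum eps n w| <= C' * expR (tau * ln N%:R).
  apply: (dyadic_growth (C := C) (p := 2 * r + 4) lt_tau) => k N leN.
  have := sqr_partial_sum_le_energy (fun n => Gsum eps n w) 0 leN.
  rewrite add0n => /le_trans; apply; have := fC k.
  by rewrite /f /wt ler_pdivrMl ?mulr_gt0 ?exprn_gt0 ?ltr0n // [C * _]mulrC.
apply: (@cvg_dirichlet _ _ C' tau).
- by have := ler0n R r; lra.
- by rewrite /tau; lra.
- by move=> N N0; have := SC' N N0; rewrite big_ltn // G0 add0r.
Qed.
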